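(* Let $\Theta$ be a topological space, $\Omega$ a set, and $c:\Omega^{<\omega}\to\mathcal{O}(\Theta)$ an open-valued non-refuting confidence function. Suppose that $H_0\subseteq\Theta$ has empty interior, and let $H_1=\Theta\setminus H_0$. Then for every world $w\in\Theta\times\Omega^{<\omega}$, $w\Vdash\lozenge H_1$; i.e. $w\Vdash\neg\square H_0$. In particular, for a two-sided hypothesis $H_0=\{\theta_0\}$ (with $\theta_0\in\Theta$ and $\{\theta_0\}$ having empty interior), no world $w$ satisfies $w\Vdash\square H_0$.
   Context: $\Omega^{<\omega}$ is the set of finite strings of elements of the sample space $\Omega$ (evidence). $\mathcal{O}(\Theta)$ is the collection of open subsets of $\Theta$. An open-valued confidence function is a map $c:\Omega^{<\omega}\to\mathcal{O}(\Theta)$; it is non-refuting if $c(E)\neq\varnothing$ for all $E\in\Omega^{<\omega}$. A world is a pair $w=(\theta_w,E_w)$ with $\theta_w\in\Theta$, $E_w\in\Omega^{<\omega}$. For $H\subseteq\Theta$: $w\Vdash\lozenge H$ iff $c(E_w)\cap H\neq\varnothing$, and $w\Vdash\square H$ iff $c(E_w)\subseteq H$ (equivalently, $\square H=\neg\lozenge\neg H$ with $\neg H=\Theta\setminus H$). Negation is interpreted as usual at each world. *)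

(* Defs.v *)
From mathcomp Require Import all_boot all_order all_algebra.
From mathcomp Require Import all_classical all_reals all_analysis.

Set Implicit Arguments.
Unset Strict Implicit.
Unset Printing Implicit Defensive.

Local Open Scope classical_set_scope.

Definition opens (T : topologicalType) : Type := {U : set T | open U}.

(* Evidence is [seq Omega], the empty string included. *)
Definition confidence_function (Theta : topologicalType) (Omega : Type) : Type :=
  seq Omega -> opens Theta.

Definition non_refuting (Theta : topologicalType) (Omega : Type)
    (c : confidence_function Theta Omega) : Prop :=
  forall E : seq Omega, sval (c E) !=set0.

Definition world (Theta : topologicalType) (Omega : Type) : Type :=
  (Theta * seq Omega)%type.

(* [Neg] acts on formulas only; negating a hypothesis [H] is complementation. *)
Inductive formula (Theta : topologicalType) : Type :=
| Diamond of set Theta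
| Box of set Theta
| Neg of formula Theta.

Fixpoint forces (Theta : topologicalType) (Omega : Type)
    (c : confidence_function Theta Omega) (w : world Theta Omega)
    (phi : formula Theta) : Prop :=
  match phi with
  | Diamond H => sval (c w.2) `&` H !=set0
  | Box H => sval (c w.2) `<=` H
  | Neg psi => ~ forces c w psi
  end.

(* Main.v *)
Require Import Defs.
From mathcomp Require Import all_boot all_order all_algebra.
From mathcomp Require Import all_classical all_reals all_analysis.

Local Open Scope classical_set_scope.

(** An open subset of [H] is contained in the interior of [H].  Confidence
    regions are open and nonempty, so none of them fits inside a hypothesis with
    empty interior ([open_not_subset_empty_interior]): no evidence ever makes
    such a hypothesis necessary.  The possibility of the complement is the same
    fact read through the classical duality between box and diamond
    ([forces_DiamondC]), and a two-sided point hypothesis is the special case of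
    a singleton. *)

Lemma open_not_subset_empty_interior (T : topologicalType) (U H : set T) :
  open U -> U !=set0 -> interior H = set0 -> ~ U `<=` H.
Proof.
by move=> oU [x Ux] intH; rewrite open_subsetE // intH => /(_ x Ux).
Qed.

(** The converse direction is the classical one: a point of the region outside
    [H] has to be extracted from the failure of the inclusion. *)
Lemma forces_DiamondC (Theta : topologicalType) (Omega : Type)
    (c : confidence_function Theta Omega) (w : world Theta Omega)
    (H : set Theta) :
  forces c w (Diamond (~` H)) <-> forces c w (Neg (Box H)).
Proof. by split=> [[x [cx nHx]] /(_ x cx) | /nonsubset]. Qed.

Lemma not_forces_Box (Theta : topologicalType) (Omega : Type)
    (c : confidence_function Theta Omega) (hc : non_refuting c)
    (w : world Theta Omega) (H : set Theta) :
  interior H = set0 -> forces c w (Neg (Box H)).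
Proof.
exact: (open_not_subset_empty_interior _ _ _ (svalP (c w.2)) (hc w.2)).
Qed.

Theorem proposition3p3 (Theta : topologicalType) (Omega : Type)
    (c : confidence_function Theta Omega) (hc : non_refuting c) :
  (forall H0 H1 : set Theta, interior H0 = set0 -> H1 = [set: Theta] `\` H0 ->
     forall w : world Theta Omega,
       forces c w (Diamond H1) /\ forces c w (Neg (Box H0)))
  /\
  (forall theta0 : Theta, interior [set theta0] = set0 ->
     ~ exists w : world Theta Omega, forces c w (Box [set theta0])).
Proof.
split=> [H0 H1 intH0 -> w | theta0 int0 [w]]; last exact: not_forces_Box.
have nbox : forces c w (Neg (Box H0)) by exact: not_forces_Box.
by rewrite setTD; split=> //; apply/forces_DiamondC.
Qed.
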